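(* Let $f_0 \neq f_1$ be probability densities, and consider observations $X_1, X_2, \dots$. For a change point $\nu \in \mathbb{N}\cup\{\infty\}$, $\Pr_\nu$ denotes the law under which $X_1,\dots,X_{\nu-1}$ are i.i.d. with density $f_0$ and $X_\nu, X_{\nu+1},\dots$ are i.i.d. with density $f_1$, independent of the former ($\Pr_\infty$: all observations i.i.d. $f_0$). Let $\delta_{\mathrm{F}}\in(0,1)$ and $r>1$, and let $\zeta(r)=\sum_{i=1}^\infty i^{-r}$. Define $W_n=\max_{1\le k\le n}\sum_{i=k}^n \log\frac{f_1(X_i)}{f_0(X_i)}$, the threshold $\beta(n,\delta_{\mathrm{F}},r)=\log\left(\zeta(r)\frac{n^r}{\delta_{\mathrm{F}}}\right)$, and the stopping time $\tau_r=\inf\{n\in\mathbb{N}: W_n\ge \beta(n,\delta_{\mathrm{F}},r)\}$. Then for every horizon $T\in\mathbb{N}$, $$\Pr_\infty(\tau_r\le T)\le \delta_{\mathrm{F}}.$$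
   Context: This is the time-varying threshold CuSum (TVT-CuSum) test for quickest change detection. The threshold $\beta$ does not depend on $T$. *)

(* Defs.v *)
From mathcomp Require Import all_boot all_order all_algebra finmap.
From mathcomp Require Import all_classical all_reals all_analysis.
Import Order.TTheory GRing.Theory Num.Theory.
Import numFieldNormedType.Exports.

Set Implicit Arguments.
Unset Strict Implicit.
Unset Printing Implicit Defensive.

Local Open Scope classical_set_scope.
Local Open Scope ring_scope.
Local Open Scope ereal_scope.

(* Observations are indexed from 1: in every sequence [X : nat -> _] below the
   entry [X 0] is unconstrained and never used. *)

Definition probability_density (d : measure_display) (E : measurableType d)
    (R : realType) (mu : {measure set E -> \bar R}) (f : E -> R) : Prop :=
  [/\ measurable_fun [set: E] f, (forall x, (0 <= f x)%R)
    & \int[mu]_x (f x)%:E = 1].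

Definition has_density (d d' : measure_display) (Omega : measurableType d)
    (E : measurableType d') (R : realType) (mu : {measure set E -> \bar R})
    (P : probability Omega R) (Y : {mfun Omega >-> E}) (f : E -> R) : Prop :=
  forall A : set E, measurable A ->
    P (Y @^-1` A) = \int[mu]_(x in A) (f x)%:E.

Definition mutually_independent (d d' : measure_display)
    (Omega : measurableType d) (E : measurableType d') (R : realType)
    (P : probability Omega R) (X : nat -> {mfun Omega >-> E}) : Prop :=
  forall (J : {fset nat}) (A : nat -> set E),
    (forall j, j \in J -> (0 < j)%N) ->
    (forall j, j \in J -> measurable (A j)) ->
    P (\bigcap_(j in [set` J]) (X j @^-1` A j)) =
      \prod_(j <- J) P (X j @^-1` A j).

(* A change point is [Some nu] with [nu >= 1], or [None] for "no change"
   ([nu] = infinity). *)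
Definition change_point_law (d d' : measure_display)
    (Omega : measurableType d) (E : measurableType d') (R : realType)
    (mu : {measure set E -> \bar R}) (f0 f1 : E -> R)
    (X : nat -> {mfun Omega >-> E}) (nu : option nat)
    (P : probability Omega R) : Prop :=
  mutually_independent P X /\
  forall i, (0 < i)%N ->
    has_density mu P (X i)
      (if nu is Some n then if (i < n)%N then f0 else f1 else f0).

(* Extended-real valued: the value is -oo where f1 vanishes (including 0/0) and
   +oo where only f0 vanishes. *)
Definition log_likelihood_ratio (T : Type) (R : realType) (f0 f1 : T -> R)
    (x : T) : \bar R :=
  lne ((f1 x)%:E / (f0 x)%:E).

(* The maximum is over a nonempty range as soon as n >= 1. *)
Definition cusum (Omega T : Type) (R : realType) (f0 f1 : T -> R)
    (X : nat -> Omega -> T) (n : nat) (w : Omega) : \bar R :=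
  \big[maxe/-oo]_(1 <= k < n.+1)
    \sum_(k <= i < n.+1) log_likelihood_ratio f0 f1 (X i w).

(* [riemannR r n] is 1 / (n + 1)^r, so this is the sum over i >= 1 of i^(-r);
   it is meaningful for r > 1. *)
Definition zeta (R : realType) (r : R) : R := limn (series (riemannR r)).

Definition tvt_threshold (R : realType) (n : nat) (deltaF r : R) : R :=
  ln (zeta r * (n%:R `^ r / deltaF))%R.

(* Valued in the extended reals; the infimum of the empty set is +oo. *)
Definition tvt_cusum_time (Omega T : Type) (R : realType) (f0 f1 : T -> R)
    (X : nat -> Omega -> T) (deltaF r : R) (w : Omega) : \bar R :=
  ereal_inf [set (n%:R)%:E | n in
    [set n : nat | (0 < n)%N /\
       (tvt_threshold n deltaF r)%:E <= cusum f0 f1 X n w]].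

(* Main.v *)
(* The CuSum statistic satisfies W_(n+1) = max(W_n, 0) + l(X_(n+1)), where l is
   the log-likelihood ratio and X_(n+1) is independent of W_n. Conditioning on
   X_(n+1), an induction on n gives Pr(W_n >= t) <= e^(-t): if t <= l(x), then
   1 <= e^(l(x) - t), and otherwise max(W_n, 0) >= t - l(x) > 0 forces
   W_n >= t - l(x), whose probability is at most e^(l(x) - t) by induction; the
   mean of e^(l(X_(n+1))) under f0 is at most 1. The threshold makes the n-th
   bound equal to deltaF / (zeta(r) n^r), and a union bound concludes. *)

Require Import Defs.
From HB Require Import structures.
From mathcomp Require Import all_boot all_order all_algebra finmap.
From mathcomp Require Import all_classical all_reals all_analysis.
From mathcomp Require Import measurable_realfun.
Import Order.TTheory GRing.Theory Num.Theory.
Import numFieldNormedType.Exports.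

Set Implicit Arguments.
Unset Strict Implicit.
Unset Printing Implicit Defensive.

Local Open Scope classical_set_scope.
Local Open Scope ring_scope.
Local Open Scope ereal_scope.

(** * Convergence of the series defining [zeta] *)

Lemma series_riemannR_nd (R : realType) (r : R) :
  {homo series (riemannR r) : m n / (m <= n)%N >-> (m <= n)%R}.
Proof.
apply: nondecreasing_series => n _ _.
by rewrite /= invr_ge0 powR_ge0.
Qed.

(* The terms of indices 2i and 2i + 1 are both at most (2i)^-r. Since
   2^(1 - r) < 1, the resulting inequality bounds the partial sums. *)
Lemma series_riemannR_double (R : realType) (r : R) (n : nat) : (0 <= r)%R ->
  (series (riemannR r) n.*2.+1 <=
    1 + 2%:R * (2%:R `^ r)^-1 * series (riemannR r) n)%R.
Proof.
move=> r0; elim: n => [|n IH].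
  by rewrite /series/= double0 big_nat1 big_geq// mulr0 addr0 /riemannR powR1 invr1.
rewrite doubleS /series/= (big_nat_recr n.*2.+2)//= (big_nat_recr n.*2.+1)//=.
rewrite (big_nat_recr n)//= mulrDr addrA -addrA lerD//.
(* The new term on the right is two copies of (2n+2)^-r; the second copy dominates (2n+3)^-r. *)
have -> : (2%:R * (2%:R `^ r)^-1 * (n.+1%:R `^ r)^-1 =
   (n.*2.+2%:R `^ r)^-1 + (n.*2.+2%:R `^ r)^-1 :> R)%R.
  rewrite -doubleS -[n.+1.*2]mul2n natrM powRM// invfM -mulrA.
  by rewrite -mulr2n mulr_natl.
rewrite lerD// lef_pV2 ?posrE ?powR_gt0 ?ltr0n//.
by apply: ge0_ler_powR; rewrite ?nnegrE// ler_nat.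
Qed.

Lemma cvg_series_riemannR (R : realType) (r : R) : (1 < r)%R ->
  cvgn (series (riemannR r)).
Proof.
move=> r1; pose q : R := (2%:R * (2%:R `^ r)^-1)%R.
have r0 : (0 <= r)%R by rewrite ltW// (lt_trans ltr01).
have q1 : (q < 1)%R.
  rewrite ltr_pdivrMr ?powR_gt0// mul1r -[ltLHS]powRr1//.
  by rewrite /powR pnatr_eq0 ltr_expR ltr_pM2r ?ln_gt0 ?ltr1n.
apply: nondecreasing_is_cvgn; first exact: series_riemannR_nd.
(* With s_n the partial sums, s_n <= s_(2n+1) <= 1 + q s_n, which solves to s_n <= 1 / (1 - q). *)
exists (1 - q)^-1%R => _ [n _ <-].
rewrite -[leRHS]mul1r ler_pdivlMr ?subr_gt0// mulrBr mulr1 lerBlDr.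
rewrite mulrC (le_trans _ (series_riemannR_double _ r0))//.
by apply: series_riemannR_nd; rewrite -addnn -addnS leq_addr.
Qed.

Lemma series_riemannR_le_zeta (R : realType) (r : R) (n : nat) : (1 < r)%R ->
  (series (riemannR r) n <= zeta r)%R.
Proof.
move=> r1; apply: nondecreasing_cvgn_le; last exact: cvg_series_riemannR.
exact: series_riemannR_nd.
Qed.

Lemma zeta_gt0 (R : realType) (r : R) : (1 < r)%R -> (0 < zeta r)%R.
Proof.
move=> r1; apply: lt_le_trans (series_riemannR_le_zeta 1%N r1).
by rewrite /series/= big_nat1 invr_gt0 powR_gt0.
Qed.

(** * The log-likelihood ratio and the CuSum recursion *)

(** The inverse of 0 is [+oo] and 0 times [+oo] is 0, so testing [f1] first settles the case 0/0.
    Measurability then reduces to real functions on measurable pieces. *)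
Lemma log_likelihood_ratioE (T : Type) (R : realType) (f0 f1 : T -> R) (x : T) :
  (0 <= f0 x)%R -> (0 <= f1 x)%R ->
  log_likelihood_ratio f0 f1 x =
  if f1 x == 0%R then -oo else if f0 x == 0%R then +oo
  else (ln (f1 x) - ln (f0 x))%:E.
Proof.
move=> f00 f10; rewrite /log_likelihood_ratio inver.
have [->|f1N0] := eqVneq (f1 x) 0%R; first by rewrite mul0e/= lexx.
have f1p : (0 < f1 x)%R by rewrite lt_neqAle eq_sym f1N0.
have [f0E|f0N0] := eqVneq (f0 x) 0%R; first by rewrite gt0_muley.
have f0p : (0 < f0 x)%R by rewrite lt_neqAle eq_sym f0N0.
by rewrite -EFinM lne_EFin ?divr_gt0// ln_div.
Qed.

Lemma measurable_log_likelihood_ratio (d : measure_display)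
    (E : measurableType d) (R : realType) (f0 f1 : E -> R) :
  (forall x, 0 <= f0 x)%R -> (forall x, 0 <= f1 x)%R ->
  measurable_fun [set: E] f0 -> measurable_fun [set: E] f1 ->
  measurable_fun [set: E] (log_likelihood_ratio f0 f1).
Proof.
move=> f00 f10 mf0 mf1.
apply: eq_measurable_fun.
  by move=> x _; rewrite (log_likelihood_ratioE (f00 x) (f10 x)).
apply: measurable_fun_ifT => //; first exact: measurable_fun_eqr.
apply: measurable_fun_ifT => //; first exact: measurable_fun_eqr.
apply/measurable_EFinP; apply: measurable_funB;
  by apply: measurableT_comp => //; exact: measurable_ln.
Qed.

Lemma measurable_likelihood_ratio (d : measure_display)
    (E : measurableType d) (R : realType) (f0 f1 : E -> R) :
  (forall x, 0 <= f0 x)%R -> (forall x, 0 <= f1 x)%R ->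
  measurable_fun [set: E] f0 -> measurable_fun [set: E] f1 ->
  measurable_fun [set: E] (fun x => expeR (log_likelihood_ratio f0 f1 x)).
Proof.
move=> f00 f10 mf0 mf1.
apply: (eq_measurable_fun (fun x => if f1 x == 0%R then 0 else
    if f0 x == 0%R then +oo else (expR (ln (f1 x) - ln (f0 x)))%:E)).
  move=> x _; rewrite (log_likelihood_ratioE (f00 x) (f10 x)).
  by case: ifP => // _; case: ifP.
apply: measurable_fun_ifT => //; first exact: measurable_fun_eqr.
apply: measurable_fun_ifT => //; first exact: measurable_fun_eqr.
apply/measurable_EFinP; apply: measurableT_comp => //.
by apply: measurable_funB;
  apply: measurableT_comp => //; exact: measurable_ln.
Qed.

(** Both sides agree unless [f0] vanishes and [f1] does not; there the product of [+oo] and 0 is 0,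
    and only the inequality remains. *)
Lemma likelihood_ratio_mul_le (T : Type) (R : realType) (f0 f1 : T -> R) (x : T) :
  (0 <= f0 x)%R -> (0 <= f1 x)%R ->
  expeR (log_likelihood_ratio f0 f1 x) * (f0 x)%:E <= (f1 x)%:E.
Proof.
move=> f00 f10; rewrite log_likelihood_ratioE//.
case: eqVneq => [_|f1N0]; first by rewrite mul0e lee_fin.
case: eqVneq => [->|f0N0]; first by rewrite mule0 lee_fin.
by rewrite -EFinM lee_fin expRB !lnK ?posrE ?lt0r ?f1N0 ?f0N0// divfK.
Qed.

Lemma cusumS (Omega T : Type) (R : realType) (f0 f1 : T -> R)
    (X : nat -> Omega -> T) (n : nat) (w : Omega) :
  cusum f0 f1 X n.+1 w =
  maxe (cusum f0 f1 X n w) 0 + log_likelihood_ratio f0 f1 (X n.+1 w).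
Proof.
rewrite /cusum big_nat_recr//= big_nat1 adde_maxl add0e; congr maxe.
rewrite big_nat_cond [in RHS]big_nat_cond.
set l := log_likelihood_ratio _ _ _.
(* Adding l commutes with the maximum, including the empty one: [-oo] + l is [-oo] even when l is
   [+oo]. *)
rewrite (big_morph (fun u => u + l) (fun u v => adde_maxl u v l) (addNye l)).
apply: eq_bigr => k /andP[/andP[_ kn] _].
by rewrite big_nat_recr// ltnW.
Qed.

Lemma measurable_cusum (d d' : measure_display)
    (Omega : measurableType d) (E : measurableType d') (R : realType)
    (f0 f1 : E -> R) (X : nat -> Omega -> E) (n : nat) :
  measurable_fun [set: E] (log_likelihood_ratio f0 f1) ->
  (forall i, measurable_fun [set: Omega] (X i)) ->
  measurable_fun [set: Omega] (cusum f0 f1 X n).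
Proof.
move=> ml mX; elim: n => [|n IH].
  rewrite (_ : cusum _ _ _ _ = cst -oo)//.
  by apply/funext => w; rewrite /cusum big_geq.
apply: eq_measurable_fun => [w _|]; first by rewrite cusumS.
apply: emeasurable_funD; first exact: measurable_maxe.
exact: measurableT_comp.
Qed.

(** * Integrals against a density, and joint laws *)

(** The law of [Y] is dominated by [mu], and its Radon-Nikodym derivative has the same integral as
    [f] over every measurable set, hence equals [f] almost everywhere. *)
Lemma ge0_integral_has_density (d d' : measure_display)
    (Omega : measurableType d) (E : measurableType d') (R : realType)
    (mu : {sigma_finite_measure set E -> \bar R}) (P : probability Omega R)
    (Y : {mfun Omega >-> E}) (f : E -> R) (g : E -> \bar R) :
  probability_density mu f -> has_density mu P Y f ->
  measurable_fun [set: E] g -> (forall x, 0 <= g x) ->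
  \int[distribution P Y]_x g x = \int[mu]_x (g x * (f x)%:E).
Proof.
move=> [mf f0 f1] dY mg g0.
have mfE : measurable_fun [set: E] (EFin \o f) by exact/measurable_EFinP.
have dom : distribution P Y `<< mu.
  move=> A A0 B mB BA; rewrite /distribution /pushforward dY//.
  apply: null_set_integral => //; first exact: measurable_funTS.
  exact: A0.
rewrite -(Radon_Nikodym_SigmaFinite.change_of_variables dom)//.
set h := Radon_Nikodym_SigmaFinite.f _ _.
have hi : mu.-integrable [set: E] h.
  exact: Radon_Nikodym_SigmaFinite.f_integrable.
apply: ae_eq_integral => //.
- by apply: emeasurable_funM => //; exact: measurable_int hi.
- exact: emeasurable_funM.
apply: ae_eqe_mul2l; apply: integral_ae_eq => // A _ mA.
rewrite -(Radon_Nikodym_SigmaFinite.f_integral dom)//.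
exact: dY.
Qed.

(** A product of sigma-finite measures is determined by its values on rectangles. [nu] is any
    measure, so that [P] restricted to an event is covered too. *)
Lemma joint_law (d d1 d2 : measure_display) (Omega : measurableType d)
    (S : measurableType d1) (E : measurableType d2) (R : realType)
    (nu : {measure set Omega -> \bar R})
    (m1 : {sigma_finite_measure set S -> \bar R})
    (m2 : {sigma_finite_measure set E -> \bar R})
    (Y : {mfun Omega >-> S}) (Z : {mfun Omega >-> E}) :
  (forall A B, measurable A -> measurable B ->
    nu (Y @^-1` A `&` Z @^-1` B) = m1 A * m2 B) ->
  forall C, measurable C ->
    nu ((fun w => (Y w, Z w)) @^-1` C) = (m1 \x m2) C.
Proof.
move=> rect C mC.
have mYZ : measurable_fun [set: Omega] (fun w => (Y w, Z w)).
  exact: measurable_fun_pair.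
pose YZ : {mfun Omega >-> (S * E)%type} :=
  HB.pack (fun w => (Y w, Z w)) (isMeasurableFun.Build _ _ _ _ _ mYZ).
rewrite (@product_measure_unique _ _ _ _ _ m1 m2 (pushforward nu YZ))//.
Qed.

(** * Independence of the past from later observations *)

(** Independence from all of X_(n+1), X_(n+2), ..., tested on finite cylinders. Independence from
    X_(n+1) alone would not propagate along the recursion. *)
Definition independent_of_future (d d1 d2 : measure_display)
    (Omega : measurableType d) (S : measurableType d1)
    (E : measurableType d2) (R : realType) (P : probability Omega R)
    (X : nat -> {mfun Omega >-> E}) (n : nat) (Y : {mfun Omega >-> S}) :=
  forall (J : {fset nat}) (A : nat -> set E) (C : set S),
    (forall j, j \in J -> (n < j)%N) ->
    (forall j, j \in J -> measurable (A j)) -> measurable C ->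
    P (Y @^-1` C `&` \bigcap_(j in [set` J]) (X j @^-1` A j)) =
      P (Y @^-1` C) * P (\bigcap_(j in [set` J]) (X j @^-1` A j)).

Section future.
Context (d d1 d2 : measure_display) (Omega : measurableType d)
  (S : measurableType d1) (E : measurableType d2) (R : realType)
  (P : probability Omega R) (X : nat -> {mfun Omega >-> E}).
Hypothesis indX : mutually_independent P X.

Lemma independent_next (n : nat) (Y : {mfun Omega >-> S}) :
  independent_of_future P X n Y ->
  forall A B, measurable A -> measurable B ->
    P (Y @^-1` A `&` X n.+1 @^-1` B) = P (Y @^-1` A) * P (X n.+1 @^-1` B).
Proof.
move=> indY A B mA mB.
have := indY [fset n.+1]%fset (fun=> B) A.
rewrite set_fset1 bigcap_set1; apply => // j.
by rewrite inE => /eqP ->.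
Qed.

Lemma cylinder_cons (J : {fset nat}) (A : nat -> set E) (n : nat) (B : set E) :
  (forall j, j \in J -> (n < j)%N) ->
  X n @^-1` B `&` \bigcap_(j in [set` J]) (X j @^-1` A j) =
  \bigcap_(j in [set` (n |` J)%fset])
    (X j @^-1` (if j == n then B else A j)).
Proof.
move=> nJ; apply/seteqP; split => w.
  move=> [/= wB wJ] j /=; rewrite !inE => /orP[/eqP ->|jJ]; first by rewrite eqxx.
  have := nJ _ jJ; case: eqVneq => [->|_ _]; first by rewrite ltnn.
  exact: wJ.
move=> wJ; split => [|j /= jJ].
  by have := wJ n; rewrite /= !inE eqxx; apply.
have := wJ j; rewrite /= !inE jJ orbT => /(_ isT).
by have := nJ _ jJ; case: eqVneq => [->|//]; rewrite ltnn.
Qed.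

Lemma measurable_cylinder (J : {fset nat}) (A : nat -> set E) :
  (forall j, j \in J -> measurable (A j)) ->
  measurable (\bigcap_(j in [set` J]) (X j @^-1` A j)).
Proof.
move=> mA; apply: fin_bigcap_measurable => // j jJ.
by rewrite -[X in measurable X]setTI; apply: measurable_funPT => //; exact: mA.
Qed.

(** For a cylinder F beyond n+1, the measures P(. and F) and P(F) P give the pair (Y, X_(n+1)) the
    same values on rectangles, hence on the preimage of [C] under [g]. *)
Lemma independent_of_future_pair (d3 : measure_display)
    (S' : measurableType d3) (n : nat) (Y : {mfun Omega >-> S})
    (Y' : {mfun Omega >-> S'}) (g : S * E -> S') :
  measurable_fun [set: S * E] g -> (forall w, Y' w = g (Y w, X n.+1 w)) ->
  independent_of_future P X n Y -> independent_of_future P X n.+1 Y'.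
Proof.
move=> mg Y'E indY J A C nJ mA mC.
set F := \bigcap_(j in _) _.
have mF : measurable F by exact: measurable_cylinder.
have mgC : measurable (g @^-1` C) by rewrite -[X in measurable X]setTI; exact: mg.
have Y'C : Y' @^-1` C = (fun w => (Y w, X n.+1 w)) @^-1` (g @^-1` C).
  by apply/seteqP; split => w /=; rewrite Y'E.
have PFfin : P F \is a fin_num by exact: fin_num_measure.
(* The factor P(F) is absorbed into the law of X_(n+1), so that the restricted measure is again a
   product on rectangles. *)
pose p := NngNum (fine_ge0 (measure_ge0 P F)).
have indF A' B : measurable A' -> measurable B ->
    mrestr P mF (Y @^-1` A' `&` X n.+1 @^-1` B) =
    distribution P Y A' * mscale p (distribution P (X n.+1)) B.
  move=> mA' mB; rewrite /mrestr -setIA [X in _ `&` X]cylinder_cons//.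
  rewrite indY//; last 2 first.
    by move=> j; rewrite !inE => /orP[/eqP ->//|/nJ /ltnW].
    by move=> j; rewrite !inE; case: eqVneq => //= _; exact: mA.
  congr (_ * _); rewrite indX//; last 2 first.
    by move=> j; rewrite !inE => /orP[/eqP ->//|/nJ]; case: j.
    by move=> j; rewrite !inE; case: eqVneq => //= _; exact: mA.
  rewrite big_fsetU1/=; last by apply/negP => /nJ; rewrite ltnn.
  rewrite eqxx /mscale/= fineK// muleC; congr (_ * _).
  rewrite [RHS]indX//; last by move=> j /nJ; case: j.
  rewrite !big_seq; apply: eq_bigr => j /nJ.
  by case: eqVneq => // ->; rewrite ltnn.
have -> : P (Y' @^-1` C `&` F) = mrestr P mF (Y' @^-1` C) by [].
rewrite Y'C (joint_law indF)//.
rewrite (@joint_law _ _ _ _ _ _ _ P (distribution P Y) (distribution P (X n.+1)))//.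
  rewrite /product_measure1/= /mscale/=.
  rewrite ge0_integralZl//=; first by rewrite fineK// muleC.
  exact: measurable_fun_xsection.
- by rewrite lee_fin fine_ge0.
- exact: independent_next indY.
Qed.

End future.

(** * Tail of the CuSum statistic when no change occurs *)

Section null_hypothesis.
Context (R : realType) (d d' : measure_display) (Omega : measurableType d)
  (E : measurableType d') (mu : {sigma_finite_measure set E -> \bar R})
  (f0 f1 : E -> R) (X : nat -> {mfun Omega >-> E}) (P : probability Omega R).
Hypotheses (hf0 : probability_density mu f0) (hf1 : probability_density mu f1)
  (hP : change_point_law mu f0 f1 X None P).

Let mf0 : measurable_fun [set: E] f0. Proof. by case: hf0. Qed.
Let f00 x : (0 <= f0 x)%R. Proof. by case: hf0. Qed.
Let mf1 : measurable_fun [set: E] f1. Proof. by case: hf1. Qed.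
Let f10 x : (0 <= f1 x)%R. Proof. by case: hf1. Qed.

Let mllr : measurable_fun [set: E] (log_likelihood_ratio f0 f1).
Proof. exact: measurable_log_likelihood_ratio. Qed.

Let cusum_step (p : \bar R * E) :=
  maxe p.1 0 + log_likelihood_ratio f0 f1 p.2.

Let measurable_cusum_step : measurable_fun [set: \bar R * E] cusum_step.
Proof.
apply: emeasurable_funD; first exact: measurable_maxe.
exact: measurableT_comp.
Qed.

(** W_n is built from X_1, ..., X_n by the recursion, starting from the constant [-oo], which is
    independent of everything. [W] bundles it with its measurability. *)
Lemma cusum_independent_of_future (n : nat) :
  exists2 W : {mfun Omega >-> \bar R},
    (forall w, W w = cusum f0 f1 X n w) & independent_of_future P X n W.
Proof.
elim: n => [|n [W WE indW]].
  exists (cst -oo); first by move=> w; rewrite /cusum big_geq.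
  move=> J A C _ _ _; rewrite preimage_cst; case: ifP => _.
    by rewrite setTI probability_setT mul1e.
  by rewrite set0I measure0 mul0e.
have mW' : measurable_fun [set: Omega] (fun w => cusum_step (W w, X n.+1 w)).
  by apply: measurableT_comp => //; exact: measurable_fun_pair.
pose W' : {mfun Omega >-> \bar R} :=
  HB.pack (fun w => cusum_step (W w, X n.+1 w))
    (isMeasurableFun.Build _ _ _ _ _ mW').
exists W'; first by move=> w; rewrite cusumS -WE.
by apply: (independent_of_future_pair hP.1 measurable_cusum_step _ indW).
Qed.

(* Not an equality: f1 may have mass on the set where f0 vanishes. *)
Lemma likelihood_ratio_mean_le (n : nat) : (0 < n)%N ->
  \int[distribution P (X n)]_x expeR (log_likelihood_ratio f0 f1 x) <= 1.
Proof.
move=> n0; have mlr := measurable_likelihood_ratio f00 f10 mf0 mf1.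
have dX := hP.2 n n0.
rewrite (ge0_integral_has_density hf0 dX)//; last by move=> x; exact: expeR_ge0.
have [_ _ <-] := hf1; apply: ge0_le_integral => //.
- by move=> x _; rewrite mule_ge0 ?expeR_ge0 ?lee_fin.
- by apply: emeasurable_funM => //; exact/measurable_EFinP.
- exact/measurable_EFinP.
- by move=> x _; exact: likelihood_ratio_mul_le.
Qed.

Lemma cusum_tail (n : nat) (t : R) :
  P [set w | t%:E <= cusum f0 f1 X n w] <= (expR (- t))%:E.
Proof.
(* The level [t] stays general: the induction hypothesis is used at t - l(x). For n = 0 the
   statistic is [-oo] and the event is empty. *)
elim: n t => [|n IH] t.
  rewrite (_ : [set w | _] = set0) ?measure0 ?lee_fin ?expR_ge0//.
  by apply/seteqP; split => // w /=; rewrite /cusum big_geq.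
have mW := measurable_cusum n mllr (fun i => measurable_funPT (X i)).
have [W WE indW] := cusum_independent_of_future n.
(* The observation comes first, so that the product measure integrates over x the probability of a
   section in W_n. *)
pose C := [set p : E * \bar R | t%:E <= cusum_step (p.2, p.1)].
have mC : measurable C.
  rewrite -[C]setTI; apply: emeasurable_fun_c_infty => //.
  by apply: measurableT_comp => //; exact: measurable_fun_pair.
have -> : [set w | t%:E <= cusum f0 f1 X n.+1 w] =
    (fun w => (X n.+1 w, W w)) @^-1` C.
  by apply/seteqP; split => w; rewrite /C/= cusumS -WE.
rewrite (@joint_law _ _ _ _ _ _ _ P (distribution P (X n.+1))
  (distribution P W))//; last first.
  move=> A B mA mB; rewrite setIC muleC.
  exact: (independent_next indW).
rewrite /product_measure1.
(* The bound e^(l(x) - t) is written as a product to make sense for infinite l(x). *)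
apply: (@le_trans _ _ (\int[distribution P (X n.+1)]_x
    ((expR (- t))%:E * expeR (log_likelihood_ratio f0 f1 x)))); last first.
  rewrite ge0_integralZl//; last 2 first.
  - exact: measurable_likelihood_ratio.
  - by move=> x _; exact: expeR_ge0.
  by rewrite -[leRHS]mule1 lee_pmul2l ?likelihood_ratio_mean_le// lte_fin expR_gt0.
apply: ge0_le_integral => //.
- exact: measurable_fun_xsection.
- by apply: emeasurable_funM => //; exact: measurable_likelihood_ratio.
move=> x _ /=; rewrite /distribution /pushforward.
have -> : W @^-1` xsection C x =
    [set w | t%:E <= maxe (cusum f0 f1 X n w) 0 + log_likelihood_ratio f0 f1 x].
  by apply/seteqP; split => w; rewrite /= -WE /xsection/= inE.
(* For l(x) = [+oo] the bound is infinite; for l(x) = [-oo] the sum is [-oo] and the event is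
   empty. *)
case: (log_likelihood_ratio f0 f1 x) => [l| |]/=.
- have [tl|lt] := leP t l.
    rewrite -EFinM -expRD (le_trans (probability_le1 _ _))//.
      rewrite -[X in measurable X]setTI; apply: emeasurable_fun_c_infty => //.
      by apply: emeasurable_funD => //; exact: measurable_maxe.
    by rewrite lee_fin -expR0 ler_expR addrC subr_ge0.
  rewrite -EFinM -expRD -[(- t + l)%R]opprK opprD opprK.
  rewrite (le_trans _ (IH (t - l)%R))//; apply: le_measure; rewrite ?inE.
  + rewrite -[X in measurable X]setTI; apply: emeasurable_fun_c_infty => //.
    by apply: emeasurable_funD => //; exact: measurable_maxe.
  + by rewrite -[X in measurable X]setTI; apply: emeasurable_fun_c_infty.
  move=> w /=; rewrite -leeBlDr// -EFinB le_max => /orP[//|].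
  by rewrite lee_fin leNgt subr_gt0 lt.
- by rewrite gt0_muley ?leey// lte_fin expR_gt0.
- rewrite mule0 (_ : [set w | _] = set0) ?measure0//.
  by apply/seteqP; split => // w /=; rewrite addeNy.
Qed.

(** Times are shifted by one to match [riemannR r n], which is 1 / (n+1)^r. Positivity of [zeta r]
    and of the power lets the exponential cancel [ln]. *)
Lemma cusum_crossing_le (deltaF r : R) (n : nat) :
  (0 < deltaF)%R -> (1 < r)%R ->
  P [set w | (tvt_threshold n.+1 deltaF r)%:E <= cusum f0 f1 X n.+1 w] <=
    (deltaF / zeta r * riemannR r n)%:E.
Proof.
move=> delta0 r1; rewrite (le_trans (cusum_tail _ _))// lee_fin.
have z0 := zeta_gt0 r1.
have p0 : (0 < n.+1%:R `^ r :> R)%R by rewrite powR_gt0.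
rewrite /tvt_threshold expRN lnK ?posrE ?mulr_gt0 ?invr_gt0//.
by rewrite !invfM invrK [leRHS]mulrAC mulrC [(_ * deltaF)%R]mulrC.
Qed.

End null_hypothesis.

(** * Union bound over the crossing times *)

Lemma tvt_cusum_time_leE (Omega T : Type) (R : realType) (f0 f1 : T -> R)
    (X : nat -> Omega -> T) (deltaF r : R) (N : nat) :
  [set w | tvt_cusum_time f0 f1 X deltaF r w <= (N%:R)%:E] =
  \bigcup_(n in `I_N)
    [set w | (tvt_threshold n.+1 deltaF r)%:E <= cusum f0 f1 X n.+1 w].
Proof.
apply/seteqP; split => [w /= tauN|w [n /= nN crossn]].
  (* Attainment of the infimum is avoided: being below N+1, it leaves some crossing time strictly
     below N+1, hence at most N. *)
  have /ereal_inf_ltP[_ [n [n0 crossn] <-]] :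
      tvt_cusum_time f0 f1 X deltaF r w < N.+1%:R%:E.
    by rewrite (le_lt_trans tauN)// lte_fin ltr_nat.
  rewrite lte_fin ltr_nat ltnS => nN.
  by exists n.-1; rewrite /= prednK.
apply: (@le_trans _ _ (n.+1%:R)%:E); last by rewrite lee_fin ler_nat.
by apply: ereal_inf_lbound; exists n.+1.
Qed.

Theorem theorem1 (R : realType) (d d' : measure_display)
    (Omega : measurableType d) (E : measurableType d')
    (mu : {sigma_finite_measure set E -> \bar R})
    (f0 f1 : E -> R)
    (hf0 : probability_density mu f0) (hf1 : probability_density mu f1)
    (hf01 : f0 <> f1)
    (X : nat -> {mfun Omega >-> E})
    (Pinf : probability Omega R)
    (hPinf : change_point_law mu f0 f1 X None Pinf)
    (deltaF r : R) (hdeltaF : (0 < deltaF < 1)%R) (hr : (1 < r)%R)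
    (T : nat) :
  Pinf [set w | tvt_cusum_time f0 f1 X deltaF r w <= (T%:R)%:E]
    <= deltaF%:E.
Proof.
have [[mf0 f00 _] [mf1 f10 _]] := (hf0, hf1).
have /andP[delta0 _] := hdeltaF.
pose cross n :=
  [set w | (tvt_threshold n.+1 deltaF r)%:E <= cusum f0 f1 X n.+1 w].
have mcross n : measurable (cross n).
  rewrite -[cross n]setTI; apply: emeasurable_fun_c_infty => //.
  apply: measurable_cusum => //.
  exact: measurable_log_likelihood_ratio.
rewrite tvt_cusum_time_leE.
apply: (@le_trans _ _ (\sum_(n < T) Pinf (cross n))).
  apply: content_subadditive => //.
  - by apply: bigcup_measurable => n _; exact: mcross.
  - by rewrite -bigcup_mkord.
apply: (@le_trans _ _ (\sum_(n < T) (deltaF / zeta r * riemannR r n)%:E)).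
  by apply: lee_sum => n _; exact: (cusum_crossing_le hf0 hf1 hPinf).
(* The sum is [deltaF] times the ratio of a partial sum of the series to its limit [zeta r], a ratio
   at most 1 for every [T]. *)
rewrite sumEFin lee_fin -mulr_sumr -(big_mkord xpredT (riemannR r)).
rewrite -mulrA ler_piMr//; [by rewrite ltW|].
rewrite mulrC ler_pdivrMr ?zeta_gt0// mul1r.
exact: series_riemannR_le_zeta.
Qed.
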